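(* Consider the step-by-step construction of $14$ lines in the projective plane, depending on two parameters $a,b$ with $a\neq 1$, $b\neq 1$, $a\neq b$, described in the context. In it the points $P_9,P_{12},P_{13},P_{24},P_{26}$ are not always triple; the conditions to have them triple are the additional incidences $$\begin{aligned}P_9&\in P_3P_4\cap P_6P_7\cap P_{17}P_{22},\\ P_{12}&\in P_2P_3\cap P_5P_7\cap P_{16}P_{19},\\ P_{13}&\in P_2P_3\cap P_6P_7\cap P_{15}P_{20},\\ P_{24}&\in P_1P_3\cap P_{18}P_{21}\cap P_{15}P_{20},\\ P_{26}&\in P_1P_4\cap P_{18}P_{21}\cap P_{17}P_{22}.\end{aligned}$$ These translate into the following algebraic conditions on $a$ and $b$: $$2a-3a^2+a^3+ab-b^2=0,$$ $$(-2+a)(2a-3a^2+a^3+ab-b^2)=0,$$ $$(-2+2a-b)(-1+b)(2a-3a^2+a^3+ab-b^2)=0.$$ Thus the curve parametrizing the configurations $\mathbb{B}_{14}$ is $$C_{14}:\quad 2a-3a^2+a^3+ab-b^2=0 .$$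
   Context: Original Böröczky configuration of $n$ lines: fix a point $Q_0$ on a circle and let $Q_\alpha$ be its rotation by the angle $\alpha$ about the center; the lines are $Q_\alpha Q_{\pi-2\alpha}$, $\alpha=2k\pi/n$, $k=0,\dots,n-1$ (the tangent at $Q_\alpha$ if $\alpha\equiv\pi-2\alpha$ mod $2\pi$). It has $\lfloor n(n-3)/6\rfloor+1$ triple points (points where three of the lines meet), i.e. $26$ for $n=14$. A configuration $\mathbb{B}_n$ is a modification of it: $n$ lines in the projective plane with the same incidences; it is degenerate if some of its points or lines coincide. The curve parametrizing the $\mathbb{B}_n$ is the curve of parameter values $(a,b)$ satisfying the condition for the construction to produce all the required triple points; individual points of this curve may still give degenerate configurations. Construction of $\mathbb{B}_{14}$ ($XY$ denotes the line through $X$ and $Y$). Points $P_1=(1:0:0)$, $P_2=(0:1:0)$, $P_3=(0:0:1)$, $P_4=(1:1:1)$. Lines $P_1P_2,\ P_1P_3,\ P_1P_4,\ P_2P_3,\ P_2P_4,\ P_3P_4$. Points $P_5=P_1P_2\cap P_3P_4$, $P_6=P_1P_3\cap P_2P_4$, and the parameter point $P_7=(a:1:1)\in P_1P_4$. Lines $P_5P_7,\ P_6P_7$. Points $P_8=P_2P_4\cap P_5P_7$, $P_9=P_3P_4\cap P_6P_7$, $P_{10}=P_1P_2\cap P_6P_7$, $P_{11}=P_1P_3\cap P_5P_7$, $P_{12}=P_2P_3\cap P_5P_7$, $P_{13}=P_2P_3\cap P_6P_7$, and the parameter point $P_{14}=(b:1:1)\in P_1P_4$. Lines $P_{10}P_{14},\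 P_{11}P_{14}$. Points $P_{15}=P_5P_7\cap P_{10}P_{14}$, $P_{16}=P_3P_4\cap P_{10}P_{14}$, $P_{17}=P_2P_4\cap P_{10}P_{14}$, $P_{18}=P_2P_3\cap P_{10}P_{14}$, $P_{19}=P_6P_7\cap P_{11}P_{14}$, $P_{20}=P_2P_4\cap P_{11}P_{14}$, $P_{21}=P_3P_4\cap P_{11}P_{14}$, $P_{22}=P_2P_3\cap P_{11}P_{14}$. Lines $P_{15}P_{20},\ P_{16}P_{19},\ P_{17}P_{22},\ P_{18}P_{21}$. Points $P_{23}=P_1P_4\cap P_{15}P_{20}$, $P_{24}=P_1P_3\cap P_{15}P_{20}$, $P_{25}=P_1P_2\cap P_{16}P_{19}$, $P_{26}=P_{17}P_{22}\cap P_{18}P_{21}$. *)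

(* Defs.v *)
From mathcomp Require Import all_boot all_order all_algebra.

Set Implicit Arguments.
Unset Strict Implicit.
Unset Printing Implicit Defensive.

Import GRing.Theory.
Local Open Scope ring_scope.

(* The projective plane over K is modelled by the subspaces of K^3: points are
   the subspaces of dimension 1 and lines those of dimension 2.  The line XY
   is the sum X + Y, and the intersection of two lines is their intersection
   as subspaces. *)

Section ProjectivePlane.

Variable K : fieldType.

Definition hpoint (x y z : K) : {vspace 'rV[K]_3} :=
  <[\row_(j < 3) [:: x; y; z]`_j]>%VS.

Definition is_point (X : {vspace 'rV[K]_3}) : bool := \dim X == 1%N.
Definition is_line (L : {vspace 'rV[K]_3}) : bool := \dim L == 2%N.

(* X is a point of the intersection of the lines L, M, N.  The lines may
   coincide: degenerate configurations are allowed.  When X is introduced as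
   the intersection of two lines that coincide, X is not a point and the
   predicate is false. *)
Definition triple_at (X L M N : {vspace 'rV[K]_3}) : bool :=
  [&& is_point X, is_line L, is_line M, is_line N
    & (X <= L)%VS && (X <= M)%VS && (X <= N)%VS].

End ProjectivePlane.

Section Construction.

Variables (K : fieldType) (a b : K).

Definition P1 : {vspace 'rV[K]_3} := hpoint 1 0 0.
Definition P2 : {vspace 'rV[K]_3} := hpoint 0 1 0.
Definition P3 : {vspace 'rV[K]_3} := hpoint 0 0 1.
Definition P4 : {vspace 'rV[K]_3} := hpoint 1 1 1.

Definition P1P2 := (P1 + P2)%VS.
Definition P1P3 := (P1 + P3)%VS.
Definition P1P4 := (P1 + P4)%VS.
Definition P2P3 := (P2 + P3)%VS.
Definition P2P4 := (P2 + P4)%VS.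
Definition P3P4 := (P3 + P4)%VS.

Definition P5 := (P1P2 :&: P3P4)%VS.
Definition P6 := (P1P3 :&: P2P4)%VS.
Definition P7 := hpoint a 1 1.

Definition P5P7 := (P5 + P7)%VS.
Definition P6P7 := (P6 + P7)%VS.

Definition P8 := (P2P4 :&: P5P7)%VS.
Definition P9 := (P3P4 :&: P6P7)%VS.
Definition P10 := (P1P2 :&: P6P7)%VS.
Definition P11 := (P1P3 :&: P5P7)%VS.
Definition P12 := (P2P3 :&: P5P7)%VS.
Definition P13 := (P2P3 :&: P6P7)%VS.
Definition P14 := hpoint b 1 1.

Definition P10P14 := (P10 + P14)%VS.
Definition P11P14 := (P11 + P14)%VS.

Definition P15 := (P5P7 :&: P10P14)%VS.
Definition P16 := (P3P4 :&: P10P14)%VS.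
Definition P17 := (P2P4 :&: P10P14)%VS.
Definition P18 := (P2P3 :&: P10P14)%VS.
Definition P19 := (P6P7 :&: P11P14)%VS.
Definition P20 := (P2P4 :&: P11P14)%VS.
Definition P21 := (P3P4 :&: P11P14)%VS.
Definition P22 := (P2P3 :&: P11P14)%VS.

Definition P15P20 := (P15 + P20)%VS.
Definition P16P19 := (P16 + P19)%VS.
Definition P17P22 := (P17 + P22)%VS.
Definition P18P21 := (P18 + P21)%VS.

Definition P23 := (P1P4 :&: P15P20)%VS.
Definition P24 := (P1P3 :&: P15P20)%VS.
Definition P25 := (P1P2 :&: P16P19)%VS.
Definition P26 := (P17P22 :&: P18P21)%VS.

Definition lines14 : seq {vspace 'rV[K]_3} :=
  [:: P1P2; P1P3; P1P4; P2P3; P2P4; P3P4; P5P7; P6P7; P10P14; P11P14;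
      P15P20; P16P19; P17P22; P18P21].

(* At least three of the fourteen lines pass through the point X.  Lines are
   counted with multiplicity when some of them coincide. *)
Definition triple_point (X : {vspace 'rV[K]_3}) : bool :=
  is_point X && (2 < count (fun L => (X <= L)%VS) lines14)%N.

Definition C14 : K := 2 * a - 3 * a ^+ 2 + a ^+ 3 + a * b - b ^+ 2.

Definition admissible : bool := [&& a != 1, b != 1 & a != b].

(* The five incidences that the construction does not impose. *)
Definition additional_incidences : bool :=
  [&& triple_at P9 P3P4 P6P7 P17P22,
      triple_at P12 P2P3 P5P7 P16P19,
      triple_at P13 P2P3 P6P7 P15P20,
      triple_at P24 P1P3 P18P21 P15P20
    & triple_at P26 P1P4 P18P21 P17P22].

(* The incidences of the 26 triple points.  All but P8, P9, P12, P13, P24, P25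
   and P26 lie on their three lines by construction.  The third lines of P8
   and P25 are the mirror images of those of P9 and P24 under the symmetry of
   the construction that exchanges the last two coordinates. *)
Definition all_incidences : bool :=
  [&& triple_at P1 P1P2 P1P3 P1P4,
      triple_at P2 P1P2 P2P3 P2P4,
      triple_at P3 P1P3 P2P3 P3P4,
      triple_at P4 P1P4 P2P4 P3P4,
      triple_at P5 P1P2 P3P4 P5P7,
      triple_at P6 P1P3 P2P4 P6P7,
      triple_at P7 P1P4 P5P7 P6P7,
      triple_at P8 P2P4 P5P7 P18P21,
      triple_at P9 P3P4 P6P7 P17P22,
      triple_at P10 P1P2 P6P7 P10P14,
      triple_at P11 P1P3 P5P7 P11P14,
      triple_at P12 P2P3 P5P7 P16P19,
      triple_at P13 P2P3 P6P7 P15P20,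
      triple_at P14 P1P4 P10P14 P11P14,
      triple_at P15 P5P7 P10P14 P15P20,
      triple_at P16 P3P4 P10P14 P16P19,
      triple_at P17 P2P4 P10P14 P17P22,
      triple_at P18 P2P3 P10P14 P18P21,
      triple_at P19 P6P7 P11P14 P16P19,
      triple_at P20 P2P4 P11P14 P15P20,
      triple_at P21 P3P4 P11P14 P18P21,
      triple_at P22 P2P3 P11P14 P17P22,
      triple_at P23 P1P4 P15P20 P16P19,
      triple_at P24 P1P3 P18P21 P15P20,
      triple_at P25 P1P2 P16P19 P17P22
    & triple_at P26 P1P4 P18P21 P17P22].

End Construction.

Arguments P1P2 {K}.
Arguments P1P3 {K}.
Arguments P1P4 {K}.
Arguments P2P3 {K}.
Arguments P2P4 {K}.
Arguments P3P4 {K}.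

(* Main.v *)
Require Import Defs.
From mathcomp Require Import all_boot all_order all_algebra.
From mathcomp Require Import ring.

Import GRing.Theory.
Local Open Scope ring_scope.

Set Implicit Arguments.
Unset Strict Implicit.
Unset Printing Implicit Defensive.

(* Lines are handled through their homogeneous coordinates, so that joins and
   meets become cross products and an incidence becomes the vanishing of a
   polynomial in a and b.  For admissible parameters every point and line of the
   construction is well defined, except P26 when b = 2 (a - 1), where the lines
   P17P22 and P18P21 coincide; this value is incompatible with C14 = 0, and
   otherwise P26 lies on P1P4 by the symmetry exchanging the last two
   coordinates. *)

(** * Homogeneous coordinates: joins, meets and incidences *)

Section LinesByCoordinates.

Variable K : fieldType.
Implicit Types (x y z p q r k : K) (v : 'rV[K]_3).

Definition vec3 x y z : 'rV[K]_3 := \row_(j < 3) [:: x; y; z]`_j.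

Definition hline p q r : {vspace 'rV[K]_3} :=
  lker (linfun (mulmxr (vec3 p q r)^T : 'rV[K]_3 -> 'rV[K]_1)).

Lemma vec3P v : {x & {y & {z | v = vec3 x y z}}}.
Proof.
exists (v 0 0), (v 0 1), (v 0 2%:R); apply/rowP=> j; rewrite !mxE.
by case: j => [[|[|[|//]]] lt_j3] /=; congr (v _ _); apply/val_inj.
Qed.

Lemma vec3_inj x y z x' y' z' :
  vec3 x y z = vec3 x' y' z' -> [/\ x = x', y = y' & z = z'].
Proof.
move=> /rowP eq_v; have := (eq_v 0, eq_v 1, eq_v 2%:R).
by rewrite !mxE /= => -[[-> ->] ->].
Qed.

Lemma vec3Z k x y z : k *: vec3 x y z = vec3 (k * x) (k * y) (k * z).
Proof. by apply/rowP=> -[[|[|[|//]]] lt_j3]; rewrite !mxE. Qed.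

Lemma vec3_eq0 x y z : (vec3 x y z == 0) = [&& x == 0, y == 0 & z == 0].
Proof.
have -> : 0 = vec3 0 0 0.
  by apply/rowP=> -[[|[|[|//]]] lt_j3]; rewrite !mxE.
apply/eqP/and3P=> [/vec3_inj[-> -> ->] //|].
by case=> /eqP-> /eqP-> /eqP->.
Qed.

Lemma mem_hline p q r x y z :
  (vec3 x y z \in hline p q r) = (p * x + q * y + r * z == 0).
Proof.
rewrite memv_ker lfunE /=; apply/eqP/eqP=> [/rowP/(_ 0)|dot0].
  rewrite !mxE !big_ord_recr big_ord0 /= !mxE /= => <-; ring.
apply/rowP=> i; rewrite !mxE !big_ord_recr big_ord0 /= !mxE /= -[RHS]dot0.
ring.
Qed.

Lemma hpoint_sub_hline x y z p q r :
  (hpoint x y z <= hline p q r)%VS = (p * x + q * y + r * z == 0).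
Proof. by rewrite -memvE mem_hline. Qed.

Lemma is_point_hpoint x y z :
  is_point (hpoint x y z) = ~~ [&& x == 0, y == 0 & z == 0].
Proof.
by rewrite /is_point dim_vline -vec3_eq0 -/(vec3 x y z); case: (_ != 0).
Qed.

(** Rank-nullity for the dot product with [(p, q, r)]: its image has dimension at most 1, and is not
    zero because the values at the three basis vectors are [p], [q] and [r]. *)
Lemma dim_hline p q r :
  ~~ [&& p == 0, q == 0 & r == 0] -> \dim (hline p q r) = 2%N.
Proof.
move=> nz; set f := linfun (mulmxr (vec3 p q r)^T : 'rV[K]_3 -> 'rV[K]_1).
have := limg_ker_dim f fullv; rewrite capfv -/f !dimvf /dim /= => dim_sum.
suff dim1 : \dim (limg f) = 1%N.
  by move: dim_sum; rewrite dim1 addn1 => -[].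
apply/eqP; rewrite eqn_leq; apply/andP; split.
  by apply: leq_trans (dimvS (subvf _)) _; rewrite dimvf.
rewrite lt0n dimv_eq0; apply: contra nz => /eqP img0.
have dot0 x y z : p * x + q * y + r * z = 0.
  by apply/eqP; rewrite -mem_hline memv_ker -memv0 -img0 memv_img ?memvf.
apply/and3P; split; apply/eqP.
- by rewrite -(dot0 1 0 0); ring.
- by rewrite -(dot0 0 1 0); ring.
- by rewrite -(dot0 0 0 1); ring.
Qed.

Lemma is_line_hline p q r :
  ~~ [&& p == 0, q == 0 & r == 0] -> is_line (hline p q r).
Proof. by move=> nz; rewrite /is_line dim_hline. Qed.

(* In both lemmas below the factor k relates the cross product of the two
   coordinate vectors to the chosen coordinates of the result. *)

Lemma hpointD k x y z x' y' z' p q r :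
    k != 0 -> ~~ [&& p == 0, q == 0 & r == 0] ->
    y * z' - z * y' = k * p -> z * x' - x * z' = k * q ->
    x * y' - y * x' = k * r ->
  (hpoint x y z + hpoint x' y' z')%VS = hline p q r.
Proof.
move=> nz_k nz Ep Eq Er; apply/eqP; rewrite eqEdim subv_add !hpoint_sub_hline.
have dotE s : k * s = 0 -> s = 0.
  by move/eqP; rewrite mulf_eq0 (negPf nz_k) => /eqP.
apply/andP; split.
  apply/andP; split; apply/eqP/dotE; rewrite !mulrDr !mulrA -Ep -Eq -Er; ring.
have -> : (hpoint x y z + hpoint x' y' z')%VS
          = span [:: vec3 x y z; vec3 x' y' z'].
  by rewrite span_cons span_seq1.
rewrite dim_hline //.
(* The join is contained in a space of dimension 2, so independence of its two spanning vectors
   suffices; were they dependent, their cross product, hence [(p, q, r)], would vanish. *)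
suff /eqP-> : free [:: vec3 x y z; vec3 x' y' z'] by [].
rewrite free_cons span_seq1 seq1_free; apply: contraR nz.
rewrite negb_and negbK.
suff cross0 : [/\ y * z' - z * y' = 0, z * x' - x * z' = 0
                & x * y' - y * x' = 0] -> [&& p == 0, q == 0 & r == 0].
  case/orP=> [/vlineP[l]|/negPn].
    rewrite vec3Z => /vec3_inj[ex ey ez]; apply: cross0.
    by split; ring: ex ey ez.
  rewrite vec3_eq0 => /and3P[/eqP ex /eqP ey /eqP ez]; apply: cross0.
  by split; ring: ex ey ez.
rewrite Ep Eq Er => -[/dotE-> /dotE-> /dotE->].
by rewrite eqxx.
Qed.

Lemma hlineI k x y z x' y' z' p q r :
    k != 0 -> ~~ [&& p == 0, q == 0 & r == 0] ->
    y * z' - z * y' = k * p -> z * x' - x * z' = k * q ->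
    x * y' - y * x' = k * r ->
  (hline x y z :&: hline x' y' z')%VS = hpoint p q r.
Proof.
move=> nz_k nz Ep Eq Er; apply/eqP; rewrite eqEsubv subv_cap !hpoint_sub_hline.
have dotE s : k * s = 0 -> s = 0.
  by move/eqP; rewrite mulf_eq0 (negPf nz_k) => /eqP.
apply/andP; split; last first.
  apply/andP; split; apply/eqP/dotE.
    by rewrite !mulrDr ![k * (_ * _)]mulrCA -Ep -Eq -Er; ring.
  by rewrite !mulrDr ![k * (_ * _)]mulrCA -Ep -Eq -Er; ring.
apply/subvP=> v; have [s [t [u ->]]] := vec3P v.
rewrite memv_cap !mem_hline => /andP[/eqP dot /eqP dot'].
(* The next three equalities say that [v] is parallel to [(p, q, r)]. They are the coordinates of
   the double cross product of [v] with the two lines, which expands into multiples of the vanishing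
   dot products [dot] and [dot']. Dividing by a non-zero coordinate then gives the scalar. *)
have Est : s * q = t * p.
  apply/eqP; rewrite -subr_eq0; apply/eqP/dotE.
  rewrite mulrBr ![k * (_ * _)]mulrCA -Ep -Eq.
  by transitivity
    (z * (x' * s + y' * t + z' * u) - z' * (x * s + y * t + z * u));
     [ring | rewrite dot dot'; ring].
have Esu : s * r = u * p.
  apply/eqP; rewrite -subr_eq0; apply/eqP/dotE.
  rewrite mulrBr ![k * (_ * _)]mulrCA -Ep -Er.
  by transitivity
    (y' * (x * s + y * t + z * u) - y * (x' * s + y' * t + z' * u));
     [ring | rewrite dot dot'; ring].
have Etu : t * r = u * q.
  apply/eqP; rewrite -subr_eq0; apply/eqP/dotE.
  rewrite mulrBr ![k * (_ * _)]mulrCA -Eq -Er.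
  by transitivity
    (x * (x' * s + y' * t + z' * u) - x' * (x * s + y * t + z * u));
     [ring | rewrite dot dot'; ring].
rewrite /hpoint -/(vec3 p q r).
apply/vlineP; have [p0|nz_p] := eqVneq p 0; last first.
  by exists (s / p); rewrite vec3Z; rewrite ![_ / p * _]mulrAC Est Esu !mulfK.
have [q0|nz_q] := eqVneq q 0; last first.
  by exists (t / q); rewrite vec3Z; rewrite ![_ / q * _]mulrAC -Est Etu !mulfK.
have nz_r : r != 0 by move: nz; rewrite p0 q0 !eqxx.
by exists (u / r); rewrite vec3Z; rewrite ![_ / r * _]mulrAC -Esu -Etu !mulfK.
Qed.

Lemma is_line_not_point (X : {vspace 'rV[K]_3}) : is_line X -> ~~ is_point X.
Proof. by rewrite /is_line /is_point => /eqP->. Qed.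

(** Certificate of non-vanishing: [u], [t], [w] are the coefficients that combine the coordinates
    into a scalar known to be non-zero. *)
Lemma coords_neq0 u t w s x y z :
    s != 0 -> s = u * x + t * y + w * z ->
  ~~ [&& x == 0, y == 0 & z == 0].
Proof.
move=> nz_s def_s; apply: contra nz_s => /and3P[/eqP x0 /eqP y0 /eqP z0].
by rewrite def_s x0 y0 z0 !mulr0 !addr0.
Qed.

(** Meant for a point lying on its first two lines by construction, so that only the third incidence
    is a condition. *)
Lemma triple_at_hlines x y z p1 q1 r1 p2 q2 r2 p3 q3 r3 :
    ~~ [&& x == 0, y == 0 & z == 0] ->
    ~~ [&& p1 == 0, q1 == 0 & r1 == 0] ->
    ~~ [&& p2 == 0, q2 == 0 & r2 == 0] ->
    ~~ [&& p3 == 0, q3 == 0 & r3 == 0] ->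
    p1 * x + q1 * y + r1 * z = 0 -> p2 * x + q2 * y + r2 * z = 0 ->
  triple_at (hpoint x y z) (hline p1 q1 r1) (hline p2 q2 r2) (hline p3 q3 r3)
    = (p3 * x + q3 * y + r3 * z == 0).
Proof.
move=> nzP nz1 nz2 nz3 dot1 dot2.
rewrite /triple_at is_point_hpoint nzP !is_line_hline //= !hpoint_sub_hline.
by rewrite dot1 dot2 eqxx.
Qed.

End LinesByCoordinates.

(** Used with [k] equal to 1 or -1 and with results having a coordinate 1 or -1, which settles both
    non-vanishing conditions. *)
Local Ltac join k :=
  by apply: (@hpointD _ k); rewrite ?oppr_eq0 ?oner_eq0 ?andbF //; try ring.
Local Ltac meet k :=
  by apply: (@hlineI _ k); rewrite ?oppr_eq0 ?oner_eq0 ?andbF //; try ring.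

(** * Points and lines independent of the parameters *)

Section FixedCoordinates.

Variable K : fieldType.

Lemma P1P2E : P1P2 = hline (0 : K) 0 1. Proof. join (1 : K). Qed.
Lemma P1P3E : P1P3 = hline (0 : K) 1 0. Proof. join (- 1 : K). Qed.
Lemma P1P4E : P1P4 = hline (0 : K) 1 (- 1). Proof. join (- 1 : K). Qed.
Lemma P2P3E : P2P3 = hline (1 : K) 0 0. Proof. join (1 : K). Qed.
Lemma P2P4E : P2P4 = hline (1 : K) 0 (- 1). Proof. join (1 : K). Qed.
Lemma P3P4E : P3P4 = hline (1 : K) (- 1) 0. Proof. join (- 1 : K). Qed.

Definition fixed_linesE := (P1P2E, P1P3E, P1P4E, P2P3E, P2P4E, P3P4E).

Lemma P5E : P5 K = hpoint 1 1 0.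
Proof. rewrite /P5 !fixed_linesE; meet (1 : K). Qed.

Lemma P6E : P6 K = hpoint 1 0 1.
Proof. rewrite /P6 !fixed_linesE; meet (- 1 : K). Qed.

End FixedCoordinates.

(** * Points and lines depending on [a] and [b] *)

Section Coordinates.

Variables (K : fieldType) (a b : K).

Local Notation c := (a - 1).

Lemma P5P7E : P5P7 a = hline 1 (- 1) (- c).
Proof. rewrite /P5P7 P5E; join (1 : K). Qed.

Lemma P6P7E : P6P7 a = hline 1 (- c) (- 1).
Proof. rewrite /P6P7 P6E; join (- 1 : K). Qed.

Lemma P8E : P8 a = hpoint 1 (1 - c) 1.
Proof. rewrite /P8 P2P4E P5P7E; meet (- 1 : K). Qed.

Lemma P9E : P9 a = hpoint 1 1 (1 - c).
Proof. rewrite /P9 P3P4E P6P7E; meet (1 : K). Qed.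

Lemma P10E : P10 a = hpoint c 1 0.
Proof. rewrite /P10 P1P2E P6P7E; meet (1 : K). Qed.

Lemma P11E : P11 a = hpoint c 0 1.
Proof. rewrite /P11 P1P3E P5P7E; meet (- 1 : K). Qed.

Lemma P12E : P12 a = hpoint 0 c (- 1).
Proof. rewrite /P12 P2P3E P5P7E; meet (1 : K). Qed.

Lemma P13E : P13 a = hpoint 0 1 (- c).
Proof. rewrite /P13 P2P3E P6P7E; meet (1 : K). Qed.

Lemma P10P14E : P10P14 a b = hline 1 (- c) (c - b).
Proof. rewrite /P10P14 P10E; join (1 : K). Qed.

Lemma P11P14E : P11P14 a b = hline 1 (c - b) (- c).
Proof. rewrite /P11P14 P11E; join (- 1 : K). Qed.

(** * Points and lines that are well defined because the parameters are admissible *)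

Hypothesis adm : admissible a b.

Lemma a_sub1_neq0 : c != 0.
Proof. by case/and3P: adm; rewrite subr_eq0. Qed.

Lemma b_sub1_neq0 : b - 1 != 0.
Proof. by case/and3P: adm; rewrite subr_eq0. Qed.

Lemma a_subb_neq0 : a - b != 0.
Proof. by case/and3P: adm; rewrite (subr_eq0 a). Qed.

(** The third coordinate minus the second is [1 + c - b = a - b]. *)
Lemma P15_neq0 : ~~ [&& b - c - c ^+ 2 == 0, b - 2 * c == 0 & 1 - c == 0].
Proof. apply: (@coords_neq0 _ 0 (- 1) 1 _ _ _ _ a_subb_neq0); ring. Qed.

Lemma P16_neq0 : ~~ [&& b - c == 0, b - c == 0 & 1 - c == 0].
Proof. apply: (@coords_neq0 _ 1 0 (- 1) _ _ _ _ b_sub1_neq0); ring. Qed.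

Lemma P17_neq0 : ~~ [&& c == 0, a - b == 0 & c == 0].
Proof. by rewrite (negPf a_sub1_neq0). Qed.

Lemma P18_neq0 : ~~ [&& (0 : K) == 0, c - b == 0 & c == 0].
Proof. by rewrite (negPf a_sub1_neq0) !andbF. Qed.

Lemma P19_neq0 : ~~ [&& b - c - c ^+ 2 == 0, 1 - c == 0 & b - 2 * c == 0].
Proof. by rewrite [X in _ && X]andbC; exact: P15_neq0. Qed.

Lemma P20_neq0 : ~~ [&& b - c == 0, 1 - c == 0 & b - c == 0].
Proof. by rewrite [X in _ && X]andbC; exact: P16_neq0. Qed.

Lemma P21_neq0 : ~~ [&& c == 0, c == 0 & a - b == 0].
Proof. by rewrite (negPf a_sub1_neq0). Qed.

Lemma P22_neq0 : ~~ [&& (0 : K) == 0, c == 0 & c - b == 0].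
Proof. by rewrite (negPf a_sub1_neq0) !andbF. Qed.

Local Ltac meet_nz k nz :=
  by apply: (@hlineI _ k); rewrite ?nz ?oppr_eq0 ?oner_eq0 //; try ring.

Lemma P15E : P15 a b = hpoint (b - c - c ^+ 2) (b - 2 * c) (1 - c).
Proof. rewrite /P15 P5P7E P10P14E; meet_nz (1 : K) P15_neq0. Qed.

Lemma P16E : P16 a b = hpoint (b - c) (b - c) (1 - c).
Proof. rewrite /P16 P3P4E P10P14E; meet_nz (1 : K) P16_neq0. Qed.

Lemma P17E : P17 a b = hpoint c (a - b) c.
Proof. rewrite /P17 P2P4E P10P14E; meet_nz (- 1 : K) P17_neq0. Qed.

Lemma P18E : P18 a b = hpoint 0 (c - b) c.
Proof. rewrite /P18 P2P3E P10P14E; meet_nz (- 1 : K) P18_neq0. Qed.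

Lemma P19E : P19 a b = hpoint (b - c - c ^+ 2) (1 - c) (b - 2 * c).
Proof. rewrite /P19 P6P7E P11P14E; meet_nz (- 1 : K) P19_neq0. Qed.

Lemma P20E : P20 a b = hpoint (b - c) (1 - c) (b - c).
Proof. rewrite /P20 P2P4E P11P14E; meet_nz (- 1 : K) P20_neq0. Qed.

Lemma P21E : P21 a b = hpoint c c (a - b).
Proof. rewrite /P21 P3P4E P11P14E; meet_nz (1 : K) P21_neq0. Qed.

Lemma P22E : P22 a b = hpoint 0 c (c - b).
Proof. rewrite /P22 P2P3E P11P14E; meet_nz (1 : K) P22_neq0. Qed.

(* (dx : dy : dz) are the coordinates of P15P20 and (dx : dz : dy) those of
   P16P19; (ex : ey : ez) are those of P17P22 and (ex : ez : ey) those of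
   P18P21. *)
Let dx := (b - 2 * c) * (b - c) - (1 - c) ^+ 2.
Let dy := (b - c) * (1 - b + c ^+ 2).
Let dz := (b - c - c ^+ 2) * (1 - c) - (b - 2 * c) * (b - c).
Let ex := (a - b) * (c - b) - c ^+ 2.
Let ey := - c * (c - b).
Let ez := c ^+ 2.

(** This is what makes [P15P20], [P16P19], [P23], [P24] and [P25] well defined. If [c = 1] then
    [- dx = (b - 1) * (a - b)], which is non-zero. Otherwise [dx + dz = (1 - c) * (b - 1 - c ^+ 2)]
    forces [b = 1 + c ^+ 2], and then [- dx = (1 - c) ^+ 3 * c], again non-zero. *)
Lemma dx_dz_neq0 : dx = 0 -> dz = 0 -> False.
Proof.
move=> dx0 dz0.
have neq1 : c - 1 != 0.
  apply/eqP=> c1; have /eqP[] := mulf_neq0 b_sub1_neq0 a_subb_neq0.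
  transitivity (- dx + (c - 1) * (2 - 2 * b + c)); first by rewrite /dx; ring.
  by rewrite dx0 c1; ring.
have nz1 : 1 - c != 0 by rewrite -oppr_eq0 opprB.
have: (1 - c) * (b - 1 - c ^+ 2) = 0.
  by rewrite -(addr0 0) -{1}dx0 -dz0 /dx /dz; ring.
move/eqP; rewrite mulf_eq0 (negPf nz1) /= => /eqP def_b.
have /eqP := mulf_neq0 (mulf_neq0 nz1 (mulf_neq0 nz1 nz1)) a_sub1_neq0.
case.
transitivity (- dx + (b - 1 - c ^+ 2) * (b - 3 * c + 1 + c ^+ 2)).
  by rewrite /dx; ring.
by rewrite dx0 def_b; ring.
Qed.

Lemma P15P20_neq0 : ~~ [&& dx == 0, dy == 0 & dz == 0].
Proof.
by apply/negP=> /and3P[/eqP dx0 _ /eqP dz0]; exact: dx_dz_neq0 dx0 dz0.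
Qed.

Lemma P16P19_neq0 : ~~ [&& dx == 0, dz == 0 & dy == 0].
Proof. by rewrite [X in _ && X]andbC; exact: P15P20_neq0. Qed.

Lemma ez_neq0 : ez != 0.
Proof. by rewrite expf_neq0 ?a_sub1_neq0. Qed.

Lemma P17P22_neq0 : ~~ [&& ex == 0, ey == 0 & ez == 0].
Proof. by rewrite (negPf ez_neq0) !andbF. Qed.

Lemma P18P21_neq0 : ~~ [&& ex == 0, ez == 0 & ey == 0].
Proof. by rewrite (negPf ez_neq0) andbF. Qed.

Local Ltac join_nz k nz :=
  by apply: (@hpointD _ k); rewrite ?nz ?oppr_eq0 ?oner_eq0 //;
     try (rewrite /dx /dy /dz /ex /ey /ez; ring).

Lemma P15P20E : P15P20 a b = hline dx dy dz.
Proof. rewrite /P15P20 P15E P20E; join_nz (1 : K) P15P20_neq0. Qed.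

Lemma P16P19E : P16P19 a b = hline dx dz dy.
Proof. rewrite /P16P19 P16E P19E; join_nz (1 : K) P16P19_neq0. Qed.

Lemma P17P22E : P17P22 a b = hline ex ey ez.
Proof. rewrite /P17P22 P17E P22E; join_nz (1 : K) P17P22_neq0. Qed.

Lemma P18P21E : P18P21 a b = hline ex ez ey.
Proof. rewrite /P18P21 P18E P21E; join_nz (1 : K) P18P21_neq0. Qed.

Definition linesE :=
  (P5P7E, P6P7E, P10P14E, P11P14E, P15P20E, P16P19E, P17P22E, P18P21E).

Lemma P23_neq0 : ~~ [&& dy + dz == 0, - dx == 0 & - dx == 0].
Proof.
apply/negP=> /and3P[/eqP dyz0]; rewrite oppr_eq0 => /eqP dx0 _.
have /eqP : (a - b) * dz = 0.
  (* This identity restates that [P15] lies on [P15P20]: eliminating [dy] leaves [dz] with the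
     factor [(1 - c) + (2 * c - b) = a - b]. *)
  transitivity ((dy + dz) * (2 * c - b) - dx * (b - c - c ^+ 2)).
    by rewrite /dx /dy /dz; ring.
  by rewrite dyz0 dx0; ring.
by rewrite mulf_eq0 (negPf a_subb_neq0) => /eqP/(dx_dz_neq0 dx0).
Qed.

Lemma P24_neq0 : ~~ [&& dz == 0, (0 : K) == 0 & - dx == 0].
Proof.
by apply/negP=> /and3P[/eqP dz0 _]; rewrite oppr_eq0 => /eqP/dx_dz_neq0; apply.
Qed.

Lemma P25_neq0 : ~~ [&& - dz == 0, dx == 0 & (0 : K) == 0].
Proof.
apply/negP=> /and3P[]; rewrite oppr_eq0 => /eqP dz0 /eqP dx0 _.
exact: dx_dz_neq0 dx0 dz0.
Qed.

(** Here [ey + ez = b * c] and [ex = c - b - 2 * b * c + b ^+ 2]; the coefficients eliminate [b] and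
    leave [c ^+ 2]. The case [b = 2 * c] is included. *)
Lemma P26_neq0 : ~~ [&& ey + ez == 0, - ex == 0 & - ex == 0].
Proof.
apply: (@coords_neq0 _ (2 * c - b + 1) (- c) 0 (c ^+ 2)); first exact: ez_neq0.
rewrite /ex /ey /ez; ring.
Qed.

Lemma P23E : P23 a b = hpoint (dy + dz) (- dx) (- dx).
Proof. rewrite /P23 P1P4E P15P20E; meet_nz (1 : K) P23_neq0. Qed.

Lemma P24E : P24 a b = hpoint dz 0 (- dx).
Proof. rewrite /P24 P1P3E P15P20E; meet_nz (1 : K) P24_neq0. Qed.

Lemma P25E : P25 a b = hpoint (- dz) dx 0.
Proof. rewrite /P25 P1P2E P16P19E; meet_nz (1 : K) P25_neq0. Qed.

(** The two lines differ by exchanging [ey] and [ez], so their cross product is [ey - ez] times the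
    stated coordinates, and [ey - ez = - (c * (2 * c - b))]. *)
Lemma P26E : 2 * c - b != 0 -> P26 a b = hpoint (ey + ez) (- ex) (- ex).
Proof.
move=> nz; rewrite /P26 P17P22E P18P21E.
have nz_k : ey - ez != 0.
  have -> : ey - ez = - (c * (2 * c - b)) by rewrite /ey /ez; ring.
  by rewrite oppr_eq0 mulf_neq0 ?a_sub1_neq0.
apply: (@hlineI _ (ey - ez)) => //; first exact: P26_neq0.
all: ring.
Qed.

Lemma is_point_P26 : is_point (P26 a b) = (2 * c - b != 0).
Proof.
have [b2c|nz] := eqVneq (2 * c - b) 0; last first.
  by rewrite P26E // is_point_hpoint P26_neq0.
apply/negbTE/is_line_not_point; rewrite /P26 P17P22E P18P21E.
have -> : ey = ez.
  by apply/eqP; rewrite -subr_eq0 /ey /ez -(mulr0 (- c)) -b2c; apply/eqP; ring.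
by rewrite capvv is_line_hline ?(negPf ez_neq0) ?andbF.
Qed.

(** * Incidences as polynomial conditions on [a] and [b] *)

Definition pointsE :=
  (P5E, P6E, P8E, P9E, P10E, P11E, P12E, P13E, P15E, P16E, P17E, P18E, P19E,
   P20E, P21E, P22E, P23E, P24E, P25E).

Definition coords_neq0E :=
  (P15_neq0, P16_neq0, P17_neq0, P18_neq0, P19_neq0, P20_neq0, P21_neq0,
   P22_neq0, P23_neq0, P24_neq0, P25_neq0, P26_neq0,
   P15P20_neq0, P16P19_neq0, P17P22_neq0, P18P21_neq0).

Local Ltac triple :=
  rewrite ?pointsE ?fixed_linesE ?linesE triple_at_hlines
    ?coords_neq0E ?oppr_eq0 ?oner_eq0 ?andbF //;
  try by rewrite /dx /dy /dz /ex /ey /ez; ring.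

Lemma mulf_eq0P (k x y : K) : k != 0 -> x = k * y -> (x == 0) = (y == 0).
Proof. by move=> nz_k ->; rewrite mulf_eq0 (negPf nz_k). Qed.

(** Here [k] is the sign by which the computed incidence polynomial differs from the stated
    condition. *)
Local Ltac factor k :=
  apply: (@mulf_eq0P k); [by rewrite ?oppr_eq0 ?oner_eq0 |
    by rewrite /C14 /dx /dy /dz /ex /ey /ez; ring].

Lemma triple_P8 :
  triple_at (P8 a) P2P4 (P5P7 a) (P18P21 a b) = (C14 a b == 0).
Proof. triple; factor (- 1 : K). Qed.

Lemma triple_P9 :
  triple_at (P9 a) P3P4 (P6P7 a) (P17P22 a b) = (C14 a b == 0).
Proof. triple; factor (- 1 : K). Qed.

Lemma triple_P12 :
  triple_at (P12 a) P2P3 (P5P7 a) (P16P19 a b) = ((- 2 + a) * C14 a b == 0).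
Proof. triple; factor (1 : K). Qed.

Lemma triple_P13 :
  triple_at (P13 a) P2P3 (P6P7 a) (P15P20 a b) = ((- 2 + a) * C14 a b == 0).
Proof. triple; factor (- 1 : K). Qed.

Lemma triple_P24 :
  triple_at (P24 a b) P1P3 (P18P21 a b) (P15P20 a b) =
    ((- 2 + 2 * a - b) * (- 1 + b) * C14 a b == 0).
Proof.
(* [P24] lies on the first and third lines by construction and the condition concerns the second, so
   [triple_at_hlines] does not fit this order. *)
rewrite /triple_at P24E is_point_hpoint P24_neq0 P1P3E !linesE.
rewrite !is_line_hline ?coords_neq0E ?oner_eq0 ?andbF //= !hpoint_sub_hline.
have -> : 0 * dz + 1 * 0 + 0 * - dx = 0 by ring.
have -> : dx * dz + dy * 0 + dz * - dx = 0 by ring.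
by rewrite eqxx andbT; factor (- 1 : K).
Qed.

Lemma triple_P25 :
  triple_at (P25 a b) P1P2 (P16P19 a b) (P17P22 a b) =
    ((- 2 + 2 * a - b) * (- 1 + b) * C14 a b == 0).
Proof. triple; factor (1 : K). Qed.

(** The coordinates of [P26] satisfy the three line equations identically, so only its being a point
    is at stake. *)
Lemma triple_P26 :
  triple_at (P26 a b) P1P4 (P18P21 a b) (P17P22 a b) = (2 * c - b != 0).
Proof.
rewrite -is_point_P26; apply/andP/idP=> [[] //|ptP26]; split=> //.
move: ptP26; rewrite is_point_P26 => /P26E->; rewrite P1P4E !linesE.
rewrite !is_line_hline ?coords_neq0E ?oner_eq0 ?andbF //= !hpoint_sub_hline.
by apply/andP; split; [apply/andP; split|]; apply/eqP; ring.
Qed.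

(* With b = 2 (a - 1) the polynomial C14 becomes (a - 1) (a - 2) ^+ 2, and
   a = 2 would give b = a. *)
Lemma C14_P26_point : C14 a b = 0 -> 2 * c - b != 0.
Proof.
move=> C0; apply/eqP=> b2c.
have /eqP[] := mulf_neq0 a_sub1_neq0 (mulf_neq0 a_subb_neq0 a_subb_neq0).
transitivity (C14 a b - (2 * c - b) * ((b - 1) * a)).
  by rewrite /C14; ring.
by rewrite C0 b2c; ring.
Qed.

(** * The incidences taken together *)

Lemma additional_incidencesE : additional_incidences a b = (C14 a b == 0).
Proof.
rewrite /additional_incidences triple_P9 triple_P12 triple_P13 triple_P24.
(* [P9] alone forces [C14 a b = 0]; conversely the other polynomial conditions are multiples of it,
   and [P26] is then a point. *)
rewrite triple_P26; have [C0|//] := eqVneq.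
by rewrite C0 !mulr0 eqxx C14_P26_point.
Qed.

Lemma all_incidencesE : all_incidences a b = (C14 a b == 0).
Proof.
apply/idP/idP=> [|C0].
  rewrite /all_incidences triple_P9.
  by move=> /and5P[_ _ _ _ /and5P[_ _ _ _ /andP[]]].
have triples0 := (triple_P8, triple_P9, triple_P12, triple_P13, triple_P24,
  triple_P25, triple_P26, C14_P26_point (eqP C0), eqP C0, mulr0, eqxx).
rewrite /all_incidences !triples0.
repeat match goal with |- is_true (_ && _) => apply/andP; split => // end.
(* The 19 remaining incidences are identities in [a] and [b]. *)
all: rewrite /P1 /P2 /P3 /P4 /P7 /P14; triple.
all: by apply/eqP; rewrite /dx /dy /dz /ex /ey /ez; ring.
Qed.

End Coordinates.

(** * Parameter values at which points fail to be triple *)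

Section NotAlwaysTriple.

Variable K : fieldType.
Hypothesis charK : [pchar K] =i pred0.

Lemma pchar0_intr_eq0 (m : int) : (m%:~R == 0 :> K) = (m == 0).
Proof.
by case: m => n; rewrite ?NegzE ?mulrNz ?oppr_eq0 -pmulrn
  ((pcharf0P K).1 charK).
Qed.

Lemma pchar0_intr_eq (m n : int) : (m%:~R == n%:~R :> K) = (m == n).
Proof. by rewrite -subr_eq0 -rmorphB /= pchar0_intr_eq0 subr_eq0. Qed.

(** Integer coordinates turn incidence in characteristic 0 into a decidable computation over
    [int]. *)
Definition int_hline (t : int * int * int) : {vspace 'rV[K]_3} :=
  hline t.1.1%:~R t.1.2%:~R t.2%:~R.

Lemma hline_intr p q r t :
    p = t.1.1%:~R -> q = t.1.2%:~R -> r = t.2%:~R ->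
  hline p q r = int_hline t.
Proof. by move=> -> -> ->. Qed.

Lemma hpoint_sub_int_hline (x y z : int) t :
  (hpoint x%:~R y%:~R z%:~R <= int_hline t)%VS =
    (t.1.1 * x + t.1.2 * y + t.2 * z == 0).
Proof. by rewrite hpoint_sub_hline -!rmorphM -!rmorphD pchar0_intr_eq0. Qed.

(* At (a, b) = (4, 5) each of P9, P12, P13 and P24 is an ordinary double
   point. *)
Let a : K := 4%:~R.
Let b : K := 5%:~R.

Definition lines14_at45 : seq (int * int * int) :=
  [:: (0, 0, 1); (0, 1, 0); (0, 1, - 1); (1, 0, 0); (1, 0, - 1); (1, - 1, 0);
      (1, - 1, - 3); (1, - 3, - 1); (1, - 3, - 2); (1, - 2, - 3);
      (- 6, 10, 16); (- 6, 16, 10); (- 7, 6, 9); (- 7, 9, 6)].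

Lemma admissible45 : admissible a b.
Proof. by rewrite /admissible -[1]/(1%:~R) !pchar0_intr_eq. Qed.

Lemma lines14_at45E : lines14 a b = map int_hline lines14_at45.
Proof.
rewrite /lines14 !fixed_linesE !(linesE admissible45) /a /b.
have eq_cons T (x y : T) s t : x = y -> s = t -> x :: s = y :: t.
  by move=> -> ->.
by do 14!(apply: (eq_cons); first by apply: hline_intr; rewrite /=; ring).
Qed.

(** The count runs over all fourteen lines, so it excludes every possible third line and not just
    the prescribed one. *)
Lemma not_triple_point45 (x y z : int) x' y' z' (X : {vspace 'rV[K]_3}) :
    X = hpoint x' y' z' -> x' = x%:~R -> y' = y%:~R -> z' = z%:~R ->
    (count (fun t : int * int * int =>
        (t.1.1 * x + t.1.2 * y + t.2 * z == 0)%R)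
      lines14_at45 <= 2)%N ->
  ~ triple_point a b X.
Proof.
move=> -> -> -> -> le2 /andP[_]; rewrite lines14_at45E count_map.
rewrite (eq_count (hpoint_sub_int_hline x y z)).
by rewrite ltnNge le2.
Qed.

Lemma P9_not_triple : ~ triple_point a b (P9 a).
Proof.
by apply: (@not_triple_point45 1 1 (- 2) _ _ _ _ (P9E _)) => //;
  rewrite /a /b; ring.
Qed.

Lemma P12_not_triple : ~ triple_point a b (P12 a).
Proof.
by apply: (@not_triple_point45 0 3 (- 1) _ _ _ _ (P12E _)) => //;
  rewrite /a /b; ring.
Qed.

Lemma P13_not_triple : ~ triple_point a b (P13 a).
Proof.
by apply: (@not_triple_point45 0 1 (- 3) _ _ _ _ (P13E _)) => //;
  rewrite /a /b; ring.
Qed.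

Lemma P24_not_triple : ~ triple_point a b (P24 a b).
Proof.
by apply: (@not_triple_point45 16 0 6 _ _ _ _ (P24E admissible45)) => //;
  rewrite /a /b; ring.
Qed.

End NotAlwaysTriple.

(** * The algebraic conditions and the curve [C14] *)

Theorem mainTheorem3 (K : fieldType) (charK : [pchar K] =i pred0) :
  (* none of the five points is triple for all values of the parameters *)
  [/\ ~ (forall a b : K, admissible a b -> triple_point a b (P9 a)),
      ~ (forall a b : K, admissible a b -> triple_point a b (P12 a)),
      ~ (forall a b : K, admissible a b -> triple_point a b (P13 a)),
      ~ (forall a b : K, admissible a b -> triple_point a b (P24 a b))
    & ~ (forall a b : K, admissible a b -> triple_point a b (P26 a b))] /\
  forall a b : K, admissible a b ->
  [/\ (* the algebraic condition given by each of the five incidences; that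
         of P26 holds as soon as P26 is a point *)
      [/\ triple_at (P9 a) P3P4 (P6P7 a) (P17P22 a b) <-> C14 a b = 0,
          triple_at (P12 a) P2P3 (P5P7 a) (P16P19 a b) <->
            (- 2 + a) * C14 a b = 0,
          triple_at (P13 a) P2P3 (P6P7 a) (P15P20 a b) <->
            (- 2 + a) * C14 a b = 0,
          triple_at (P24 a b) P1P3 (P18P21 a b) (P15P20 a b) <->
            (- 2 + 2 * a - b) * (- 1 + b) * C14 a b = 0
        & is_point (P26 a b) ->
            triple_at (P26 a b) P1P4 (P18P21 a b) (P17P22 a b)],
      (* the five incidences together *)
      additional_incidences a b <->
        [/\ C14 a b = 0,
            (- 2 + a) * C14 a b = 0
          & (- 2 + 2 * a - b) * (- 1 + b) * C14 a b = 0]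
    & (* the curve C_14 *)
      all_incidences a b <-> C14 a b = 0].

Proof.
split=> [|a b adm].
  have adm45 := admissible45 charK.
  split=> triple.
  - exact: P9_not_triple charK (triple _ _ adm45).
  - exact: P12_not_triple charK (triple _ _ adm45).
  - exact: P13_not_triple charK (triple _ _ adm45).
  - exact: P24_not_triple charK (triple _ _ adm45).
  - (* at (3, 4) the lines P17P22 and P18P21 coincide *)
    have adm34 : admissible (3%:~R : K) 4%:~R.
      by rewrite /admissible -[1]/(1%:~R) !(pchar0_intr_eq charK).
    have /andP[] := triple _ _ adm34; rewrite is_point_P26 // => /eqP[]; ring.
split; last first.
- by rewrite all_incidencesE //; split=> /eqP.
- rewrite additional_incidencesE //; split=> [/eqP C0|[-> //]].
  by rewrite C0 !mulr0.
rewrite triple_P9 // triple_P12 // triple_P13 // triple_P24 // triple_P26 //.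
by rewrite is_point_P26 //; split=> //; split=> /eqP.
Qed.
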